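(* Let $\nu$ be an admissible profile. The topological vector space $S^\nu$ is not $p$-normable for any $p>0$; that is, for no $p$ (with $0<p\le1$, the range for which $p$-norms are defined) is there a $p$-norm on $S^\nu$ defining its topology.
   Context: Let $\mathbb{N}_0=\{0,1,2,\dots\}$, $\Lambda=\bigcup_{j\in\mathbb{N}_0}\{j\}\times\{0,\dots,2^j-1\}$ and $\Omega=\mathbb{C}^\Lambda$. An admissible profile is a non-decreasing right-continuous function $\nu:\mathbb{R}\to\{-\infty\}\cup[0,1]$ that is not identically $-\infty$. The asymptotic profile of $x\in\Omega$ is $\nu_x(\alpha)=\lim_{\varepsilon\to0^+}\limsup_{j\to\infty}\frac{\log \#\{k:|x_{j,k}|\ge 2^{-(\alpha+\varepsilon)j}\}}{\log(2^j)}$ (with $\log 0=-\infty$), and $S^\nu=\{x\in\Omega:\nu_x(\alpha)\le\nu(\alpha)\ \forall\alpha\in\mathbb{R}\}$, which is a vector space. For $\alpha\in\mathbb{R}$ and $\beta\in\{-\infty\}\cup[0,+\infty)$ let $d_{\alpha,\beta}(x,y)=d_{\alpha,\beta}(x-y)$ with $d_{\alpha,\beta}(x)=\inf\{C\ge0:\ \forall j\in\mathbb{N}_0,\ \#\{k:|x_{j,k}|\ge C2^{-\alpha j}\}\le C2^{\beta j}\}$ (with $2^{\beta j}:=0$ if $\beta=-\infty$), and let $E(\alpha,\beta)=\{x\in\Omega:d_{\alpha,\beta}(x)<\infty\}$ with the metric $d_{\alpha,\beta}$. For any sequence $(\alpha_n)$ dense in $\mathbb{R}$ and any sequence $\varepsilon_m\searrow0$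 of positive reals, $S^\nu=\bigcap_{n,m}E(\alpha_n,\nu(\alpha_n)+\varepsilon_m)$, and the topology of $S^\nu$ is the coarsest topology making all inclusions $S^\nu\subset E(\alpha_n,\nu(\alpha_n)+\varepsilon_m)$ continuous. It is known that this topology does not depend on the choice of these sequences and makes $S^\nu$ a complete metrizable topological vector space. For $0<p\le1$, a $p$-norm on a complex vector space $X$ is a map $q:X\to[0,+\infty)$ with $q(\lambda x)=|\lambda|q(x)$, $q(x+y)^p\le q(x)^p+q(y)^p$ for all $x,y\in X$, $\lambda\in\mathbb{C}$, and $q(x)=0$ only for $x=0$. *)

(* Defs.v *)
From HB Require Import structures.
From mathcomp Require Import all_boot all_order all_algebra.
From mathcomp Require Import all_classical all_reals all_analysis.
From mathcomp Require Import complex lra.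

Set Implicit Arguments.
Unset Strict Implicit.
Unset Printing Implicit Defensive.

Import Order.TTheory GRing.Theory Num.Theory.
Import numFieldNormedType.Exports.
Import Normc.

Local Open Scope classical_set_scope.
Local Open Scope ring_scope.

Definition Lam : Type := {j : nat & 'I_(2 ^ j)%N}.

Definition Omega (R : realType) : Type := Lam -> R[i]^o.

Section Counting.
Context {R : realType}.
Implicit Types (x y : Omega R) (j : nat) (a e s t C : R) (b : \bar R).

Definition coef x j (k : 'I_(2 ^ j)%N) : R[i] :=
  x (Tagged (fun j => 'I_(2 ^ j)%N) k).

Definition card_ge x j t : nat := #|[pred k : 'I_(2 ^ j)%N | t <= normc (coef x k)]|.

(* [lne 0 = -oo] is the convention [log 0 = -oo]; the value at [j = 0], where
   [log (2^j) = 0], does not affect the limsup below. *)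
Definition log_ratio x j t : \bar R :=
  (lne (card_ge x j t)%:R%:E * ((ln (2 ^+ j))^-1)%:E)%E.

Definition asymptotic_profile x a : \bar R :=
  lim (limn_esup (fun j => log_ratio x j (2 `^ (- ((a + e) * j%:R))))
         @[e --> 0^'+]).

(* [2 ^ (b j)] for [b] in {-oo} U [0, +oo[; the value 0 at [b = +oo] is junk and
   is never reached, since profiles are bounded by 1. *)
Definition pow2 b j : R := if b is r%:E then 2 `^ (r * j%:R) else 0.

(* The set over which the infimum defining d_{a,b}(x) is taken; [dist a b x] is
   [+oo] when this set is empty. *)
Definition dist_bound a b x C : Prop := 0 <= C /\
  forall j, (card_ge x j (C * 2 `^ (- (a * j%:R))))%:R <= C * pow2 b j.

Definition dist a b x : \bar R := ereal_inf [set C%:E | C in dist_bound a b x].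

Lemma pow2_ge0 b j : 0 <= pow2 b j.
Proof. by case: b => [r| |] //=; exact: powR_ge0. Qed.

Lemma le_card_ge x j s t : s <= t -> (card_ge x j t <= card_ge x j s)%N.
Proof.
move=> st; apply/subset_leq_card/fintype.subsetP => k.
by rewrite !inE; exact: le_trans.
Qed.

Lemma card_geD x y j s t :
  (card_ge (x + y)%R j (s + t) <= card_ge x j s + card_ge y j t)%N.
Proof.
rewrite -cardUI; apply: leq_trans (leq_addr _ _).
apply/subset_leq_card/fintype.subsetP => k.
rewrite !inE => stk; rewrite !leNgt -negb_and; apply: contraL stk => /andP[xs yt].
by rewrite -ltNge (le_lt_trans (le_normcD _ _))// ltrD.
Qed.

Lemma card_geN x j t : card_ge (- x)%R j t = card_ge x j t.
Proof.
by apply: eq_card => k; rewrite !inE /coef /=; congr (_ <= _); exact: normcN.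
Qed.

Lemma normc_ge0 (z : R[i]) : 0 <= normc z.
Proof. by case: z => u v; exact: sqrtr_ge0. Qed.

Lemma card_geZ (l : R[i]) x j t M : 0 < M -> normc l <= M ->
  (card_ge (l *: x)%R j t <= card_ge x j (t / M))%N.
Proof.
move=> M0 lM; apply/subset_leq_card/fintype.subsetP => k.
rewrite !inE /coef /= => /le_trans tk; rewrite ler_pdivrMr//; apply: tk.
by rewrite [normc _]normcM mulrC ler_wpM2l// normc_ge0.
Qed.

Lemma card_ge_eq0 x j t : (forall k : 'I_(2 ^ j)%N, normc (coef x k) < t) -> card_ge x j t = 0%N.
Proof. by move=> xt; apply: eq_card0 => k; rewrite !inE leNgt xt. Qed.

Lemma dist_boundS a b x C D : C <= D -> dist_bound a b x C -> dist_bound a b x D.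
Proof.
move=> CD [C0 xC]; split=> [|j]; first exact: le_trans CD.
rewrite (le_trans _ (ler_wpM2r (pow2_ge0 b j) CD))//; apply: le_trans (xC j).
by rewrite ler_nat le_card_ge// ler_wpM2r// powR_ge0.
Qed.

Lemma dist_boundD a b x y C D : dist_bound a b x C -> dist_bound a b y D ->
  dist_bound a b (x + y) (C + D).
Proof.
move=> [C0 xC] [D0 yD]; split=> [|j]; first exact: addr_ge0.
rewrite !mulrDl; apply: le_trans (lerD (xC j) (yD j)).
by rewrite -natrD ler_nat card_geD.
Qed.

Lemma dist_boundN a b x C : dist_bound a b (- x) C <-> dist_bound a b x C.
Proof.
by split=> -[C0 xC]; split=> // j; [rewrite -card_geN|rewrite card_geN].
Qed.

Lemma dist_bound0 a b C : 0 < C -> dist_bound a b 0 C.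
Proof.
move=> C0; split=> [|j]; first exact: ltW.
rewrite card_ge_eq0 ?mulr_ge0 ?pow2_ge0 ?ltW// => k.
by rewrite /coef [X in normc X]/= [normc _]normc0 mulr_gt0// powR_gt0.
Qed.

Lemma dist_ge0 a b x : (0 <= dist a b x)%E.
Proof. by apply: le_ereal_inf_tmp => _ [C [C0 _] <-]; rewrite lee_fin. Qed.

Lemma dist_le a b x C : dist_bound a b x C -> (dist a b x <= C%:E)%E.
Proof. by move=> xC; apply: ereal_inf_lbound; exists C. Qed.

Lemma dist_lt a b x C : (dist a b x < C%:E)%E -> dist_bound a b x C.
Proof.
move=> /ereal_inf_lt[_ [D xD <-]]; rewrite lte_fin => /ltW DC.
exact: dist_boundS xD.
Qed.

Lemma distN a b x : dist a b (- x) = dist a b x.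
Proof.
by congr ereal_inf; apply/seteqP; split=> _ [C /dist_boundN xC <-]; exists C.
Qed.

Lemma dist0 a b : dist a b 0 = 0%E.
Proof.
apply/eqP; rewrite eq_le dist_ge0 andbT; apply/lee_addgt0Pr => e e0.
by rewrite add0e dist_le//; exact: dist_bound0.
Qed.

Lemma distD a b x y : (dist a b (x + y)%R <= dist a b x + dist a b y)%E.
Proof.
have [xfin|] := boolP (dist a b x \is a fin_num); last first.
  rewrite ge0_fin_numE ?dist_ge0// -leNgt leye_eq => /eqP->.
  by rewrite addye ?leey// gt_eqF// (lt_le_trans _ (dist_ge0 a b y)).
have [yfin|] := boolP (dist a b y \is a fin_num); last first.
  rewrite ge0_fin_numE ?dist_ge0// -leNgt leye_eq => /eqP->.
  by rewrite addey ?leey// gt_eqF// (lt_le_trans _ (dist_ge0 a b x)).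
apply/lee_addgt0Pr => e e0.
have -> : (dist a b x + dist a b y + e%:E =
    (fine (dist a b x) + e / 2 + (fine (dist a b y) + e / 2))%:E)%E.
  rewrite addrACA -splitr !EFinD !fineK//.
apply/dist_le/dist_boundD; apply: dist_lt;
  by rewrite EFinD fineK// lteDl// lte_fin divr_gt0.
Qed.

Lemma dist_eq0 a b x : dist a b x = 0%E -> x = 0.
Proof.
move=> x0; have xC C : 0 < C -> dist_bound a b x C.
  by move=> C0; apply: dist_lt; rewrite x0 lte_fin.
apply/funext => -[j k]; apply: eq0_normc.
apply/eqP; rewrite -[_ == _]negbK; apply/negP => n0.
have {n0} n0 : 0 < normc (coef x k) by rewrite lt0r n0 normc_ge0.
set w := 2 `^ (- (a * j%:R)) : R; have w0 : 0 < w by rewrite powR_gt0.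
set p := pow2 b j; have p0 : 0 <= p := pow2_ge0 b j.
pose C := Num.min (normc (coef x k) / w) (2 * (p + 1))^-1.
have C0 : 0 < C by rewrite lt_min divr_gt0// invr_gt0 mulr_gt0// ltr_wpDl.
have [_ /(_ j)] := xC C C0; apply/negP; rewrite -ltNge.
apply: (@lt_le_trans _ _ 1).
  rewrite (@le_lt_trans _ _ ((2 * (p + 1))^-1 * p))//.
    by rewrite ler_wpM2r// ge_min lexx orbT.
  by rewrite mulrC ltr_pdivrMr ?mul1r ?mulr_gt0 ?ltr_wpDl//; lra.
rewrite ler1n; apply/card_gt0P; exists k; rewrite !inE.
by rewrite -ler_pdivlMr// ge_min lexx.
Qed.


Lemma log_ratio_le x j s t : s <= t -> (log_ratio x j t <= log_ratio x j s)%E.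
Proof.
move=> st; rewrite /log_ratio lee_wpmul2r//.
  by rewrite lee_fin invr_ge0 ln_ge0// exprn_ege1// ler1n.
rewrite lee_lne ?in_itv/= ?andbT ?lee_fin ?leey ?ler0n// ler_nat.
exact: le_card_ge.
Qed.

Let ln2X j : (0 < j)%N -> 0 < ln (2 ^+ j : R).
Proof. by move=> j0; rewrite ln_gt0// exprn_egt1 -?lt0n// ltr1n. Qed.

Let ln_pow2 r j : ln (2 `^ (r * j%:R) : R) = r * ln (2 ^+ j).
Proof. by rewrite ln_powR lnXn// -mulrA mulr_natl. Qed.

Lemma log_ratio_lt x j t r : (0 < j)%N -> (log_ratio x j t < r%:E)%E ->
  (card_ge x j t)%:R <= (2 `^ (r * j%:R) : R).
Proof.
move=> /ln2X j0; rewrite /log_ratio.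
have [->|c0] := posnP (card_ge x j t); first by rewrite powR_ge0.
rewrite lne_EFin ?ltr0n// -EFinM lte_fin ltr_pdivrMr// -ln_pow2.
by rewrite ltr_ln ?posrE ?ltr0n ?powR_gt0// => /ltW.
Qed.

Lemma log_ratio_lt0 x j t : (0 < j)%N -> (log_ratio x j t < 0)%E ->
  card_ge x j t = 0%N.
Proof.
move=> /ln2X j0; apply: contraPP => /eqP; rewrite -lt0n => c0.
apply/negP; rewrite -leNgt /log_ratio mule_ge0//.
  by rewrite lne_ge0 lee_fin ler1n.
by rewrite lee_fin invr_ge0 ltW.
Qed.

Lemma log_ratio_leP x j t b : b != +oo%E -> (0 < j)%N ->
  (card_ge x j t)%:R <= pow2 b j -> (log_ratio x j t <= b)%E.
Proof.
move=> boo /ln2X j0; rewrite /log_ratio.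
have [->|c0] := posnP (card_ge x j t).
  by rewrite le0_lneNy// gt0_mulNye ?leNye// lte_fin invr_gt0.
case: b boo => [r| |]// _; last by rewrite /pow2 lern0 -leqn0 leqNgt c0.
rewrite lne_EFin ?ltr0n// -EFinM lee_fin ler_pdivrMr// -ln_pow2 /= => cr.
by rewrite ler_ln ?posrE ?ltr0n ?powR_gt0.
Qed.

Lemma limn_esup_lt (u : (\bar R)^nat) b : (limn_esup u < b)%E ->
  \forall j \near \oo, (u j < b)%E.
Proof.
move=> /ereal_inf_lt[_ [V Voo <-]] uV; apply: filterS Voo => j Vj.
by apply: le_lt_trans uV; apply: ereal_sup_ubound; exists j.
Qed.

Lemma limn_esup_le (u : (\bar R)^nat) b : (\forall j \near \oo, (u j <= b)%E) ->
  (limn_esup u <= b)%E.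
Proof.
move=> ub; apply: ge_ereal_inf; exists (ereal_sup [set u j | j in [set j | u j <= b]%E]).
  by exists [set j | u j <= b]%E.
by apply: ge_ereal_sup => _ [j + <-].
Qed.

Lemma le_limn_esup (u v : (\bar R)^nat) : (forall j, u j <= v j)%E ->
  (limn_esup u <= limn_esup v)%E.
Proof.
move=> uv; apply: le_ereal_inf_tmp => _ [V Voo <-]; apply: limn_esup_le.
apply: filterS Voo => j Vj; apply: le_trans (uv j) _.
by apply: ereal_sup_ubound; exists j.
Qed.

Lemma asymptotic_profileE x a : asymptotic_profile x a =
  ereal_inf [set limn_esup (fun j => log_ratio x j (2 `^ (- ((a + e) * j%:R)))) |
    e in `]0, +oo[].
Proof.
apply/cvg_lim => //; apply: nondecreasing_at_right_cvge => //= e e' _ _ ee'.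
apply: le_limn_esup => j; apply: log_ratio_le.
by rewrite ler_powR ?ler1n// lerN2 ler_wpM2r// lerD2l.
Qed.

Lemma asymptotic_profile_leP x a b : b != +oo%E ->
  (asymptotic_profile x a <= b)%E <->
  forall h, 0 < h -> exists2 e, 0 < e & \forall j \near \oo,
    (card_ge x j (2 `^ (- ((a + e) * j%:R))))%:R <= pow2 (b + h%:E) j.
Proof.
rewrite asymptotic_profileE; case: b => [r| |]// _; split.
- move=> ler h h0.
  have rh : (r%:E < (r + h)%:E)%E by rewrite lte_fin ltrDl.
  have /ereal_inf_lt[_ [e /= + <-] /limn_esup_lt] := le_lt_trans ler rh.
  rewrite in_itv/= andbT => e0 eh; exists e => //.
  near=> j; apply: log_ratio_lt; [by near: j; exists 1%N|by near: j].
- move=> H; apply/lee_addgt0Pr => h h0; have [e e0 he] := H h h0.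
  apply: ge_ereal_inf; eexists; first by exists e; rewrite //= in_itv/= e0.
  apply: limn_esup_le; near=> j.
  by apply: log_ratio_leP => //; near: j => //; exists 1%N.
- move=> leN h h0.
  have /ereal_inf_lt[_ [e /= + <-] /limn_esup_lt] :=
    le_lt_trans leN (ltNyr (0 : R)).
  rewrite in_itv/= andbT => e0 eh; exists e => //.
  near=> j; rewrite log_ratio_lt0//; [by near: j; exists 1%N|by near: j].
- move=> H; have [e e0 he] := H 1 ltr01.
  apply: ge_ereal_inf; eexists; first by exists e; rewrite //= in_itv/= e0.
  apply: limn_esup_le; near=> j.
  by apply: log_ratio_leP => //; near: j => //; exists 1%N.
Unshelve. all: by end_near. Qed.

End Counting.

Definition admissible (R : realType) (nu : R -> \bar R) : Prop :=
  [/\ forall a, nu a = -oo%E \/ (0 <= nu a <= 1)%E,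
      {homo nu : a b / a <= b >-> (a <= b)%E},
      forall a, nu b @[b --> a^'+] --> nu a &
      exists a, nu a <> -oo%E].

Record profile (R : realType) :=
  Profile { profile_fun :> R -> \bar R; _ : admissible profile_fun }.

Section Subspaces.
Context {R : realType}.
Implicit Types (a e h : R) (b : \bar R).

Lemma profileP (nu : profile R) : admissible nu. Proof. by case: nu. Qed.

Lemma profile_neqy (nu : profile R) a : nu a != +oo%E.
Proof.
by have [/(_ a) + _ _ _] := profileP nu => -[->//|/andP[_]]; case: (nu a).
Qed.

Definition in_E a b : {pred Omega R} := fun x => (dist a b x < +oo)%E.

Definition in_Snu (nu : profile R) : {pred Omega R} :=
  fun x => `[< forall a, (asymptotic_profile x a <= nu a)%E >].

Lemma in_SnuP (nu : profile R) (x : Omega R) : x \in in_Snu nu <->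
  forall a h, 0 < h -> exists2 e, 0 < e & \forall j \near \oo,
    (card_ge x j (2 `^ (- ((a + e) * j%:R))))%:R <= pow2 (nu a + h%:E)%E j.
Proof.
split=> [/asboolP xnu a|xnu].
  by have [+ _] := asymptotic_profile_leP x a (profile_neqy nu a); exact.
apply/asboolP => a.
by have [_] := asymptotic_profile_leP x a (profile_neqy nu a); apply; exact: xnu.
Qed.

Lemma pow2_double b h j : 2 / h <= j%:R ->
  0 < h -> pow2 (b + (h / 2)%:E)%E j *+ 2 <= pow2 (b + h%:E)%E j.
Proof.
move=> hj h0; case: b => [r| |]; rewrite /pow2 /= ?mul0rn//.
have -> : 2 `^ ((r + h / 2) * j%:R) *+ 2 = 2 `^ ((r + h / 2) * j%:R + 1) :> R.
  by rewrite powRD ?powRr1 ?mulr_natr ?pnatr_eq0 ?implybT.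
rewrite ler_powR ?ler1n//; move: hj; rewrite ler_pdivrMr//; lra.
Qed.

Lemma in_Snu_submod (nu : profile R) : GRing.submod_closed (in_Snu nu).
Proof.
split=> [|l x y /in_SnuP xnu /in_SnuP ynu]; apply/in_SnuP => a h h0.
  exists 1 => //; near=> j; rewrite card_ge_eq0 ?pow2_ge0// => k.
  by rewrite /coef [X in normc X]/= [normc _]normc0 powR_gt0.
have h20 : 0 < h / 2 by rewrite divr_gt0.
have [e e0 xe] := xnu a _ h20; have [e' e'0 ye'] := ynu a _ h20.
pose M := 2 * (normc l + 1).
have M2 : 2 <= M by have := normc_ge0 l; rewrite /M; lra.
have M0 : 0 < M by lra.
pose d := Num.min e e' / 2.
have d0 : 0 < d by rewrite divr_gt0// lt_min e0.
have de : d + d <= e by rewrite /d -splitr ge_min lexx.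
have de' : d + d <= e' by rewrite /d -splitr ge_min lexx orbT.
exists d => //; near=> j.
have Mj : M <= 2 `^ (d * j%:R).
  rewrite -[leLHS]lnK ?posrE// -[leRHS]lnK ?posrE ?powR_gt0// ler_expR ln_powR.
  rewrite -ler_pdivrMr ?ln_gt0 ?ltr1n// mulrC -ler_pdivrMl// mulrC.
  by near: j; exact: nbhs_infty_ger.
have tM f : d + d <= f ->
    2 `^ (- ((a + f) * j%:R)) <= 2 `^ (- ((a + d) * j%:R)) / M :> R.
  move=> df; rewrite ler_pdivlMr// (le_trans (ler_wpM2l (powR_ge0 _ _) Mj))//.
  rewrite -powRD; last by rewrite pnatr_eq0 implybT.
  rewrite ler_powR ?ler1n// -!mulNr -mulrDl ler_wpM2r//; lra.
set t := 2 `^ _ in tM *; have t0 : 0 <= t by exact: powR_ge0.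
have hj : 2 / h <= j%:R by near: j; exact: nbhs_infty_ger.
apply: le_trans (pow2_double _ hj h0).
have xj : (card_ge x j (2 `^ (- ((a + e) * j%:R))))%:R <= pow2 (nu a + (h / 2)%:E)%E j.
  by near: j.
have yj : (card_ge y j (2 `^ (- ((a + e') * j%:R))))%:R <= pow2 (nu a + (h / 2)%:E)%E j.
  by near: j.
rewrite mulr2n; apply: le_trans (lerD xj yj); rewrite -natrD ler_nat.
rewrite [t]splitr; apply: leq_trans (card_geD _ _ _ _ _) _; apply: leq_add.
  have l1 : 0 < normc l + 1 by have := normc_ge0 l; lra.
  apply: leq_trans (card_geZ _ _ _ l1 _) _; first by rewrite lerDl.
  by rewrite -mulrA -invfM le_card_ge// tM.
apply: le_card_ge; apply: le_trans (tM _ de') _.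
by rewrite ler_wpM2l// lef_pV2 ?posrE.
Unshelve. all: by end_near. Qed.

Lemma sub_Snu_E (nu : profile R) a (e : {posnum R}) (x : Omega R) :
  x \in in_Snu nu -> x \in in_E a (nu a + e%:num%:E)%E.
Proof.
move=> /in_SnuP/(_ a e%:num)[//|d d0 [J _ xJ]].
pose w j : R := 2 `^ (- (a * j%:R)).
have w0 j : 0 < w j by rewrite powR_gt0.
pose C := 1 + \sum_(j < J) \sum_(k < 2 ^ j) normc (coef x k) / w j.
have C1 : 1 <= C.
  rewrite lerDl; apply: sumr_ge0 => j _; apply: sumr_ge0 => k _.
  by rewrite divr_ge0 ?normc_ge0// ltW.
apply: (@le_lt_trans _ _ C%:E); last exact: ltry.
apply: dist_le; split=> [|j]; first exact: le_trans C1.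
have [Jj|jJ] := leqP J j.
  apply: le_trans (ler_peMl (pow2_ge0 _ _) C1); apply: le_trans (xJ j Jj).
  rewrite ler_nat le_card_ge//; apply: (@le_trans _ _ (w j)).
    by rewrite ler_powR ?ler1n// lerN2 ler_wpM2r// lerDl ltW.
  by rewrite ler_peMl// ltW.
rewrite card_ge_eq0 ?mulr_ge0 ?pow2_ge0 ?(le_trans _ C1)// => k.
rewrite -ltr_pdivrMr; last exact: w0.
rewrite /C (bigD1 (Ordinal jJ))//= (bigD1 k)//=.
rewrite -[ltLHS]add0r; apply: ltr_leD => //.
rewrite -addrA lerDl addr_ge0//; apply: sumr_ge0 => i _.
  by rewrite divr_ge0 ?normc_ge0// ltW.
by apply: sumr_ge0 => k' _; rewrite divr_ge0 ?normc_ge0// ltW.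
Qed.

End Subspaces.

HB.instance Definition _ (R : realType) (nu : profile R) :=
  GRing.isSubmodClosed.Build R[i] (Omega R) (in_Snu nu) (in_Snu_submod nu).

Section Spaces.
Context {R : realType}.

(* [Espace] and [Snu] are fresh record types rather than sigma types so that they
   carry only the topologies declared here. *)
Record Espace (a : R) (b : \bar R) :=
  MkEspace { Espace_val :> Omega R; Espace_valP : Espace_val \in in_E a b }.
HB.instance Definition _ a b := [isSub for @Espace_val a b].
HB.instance Definition _ a b := [Choice of Espace a b by <:].

Section EspaceMetric.
Variables (a : R) (b : \bar R).
Implicit Types x y z : Espace a b.

Definition Espace_dist x y : R := fine (dist a b (val x - val y)).

Let distB_fin x y : dist a b (val x - val y) \is a fin_num.
Proof.
rewrite ge0_fin_numE ?dist_ge0// (le_lt_trans (distD _ _ _ _))// distN.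
by rewrite lte_add_pinfty//; [exact: (valP x)|exact: (valP y)].
Qed.

Let Espace_distxx x : Espace_dist x x = 0.
Proof. by rewrite /Espace_dist subrr dist0. Qed.

Let Espace_dist_eq0 x y : Espace_dist x y = 0 -> x = y.
Proof.
move=> xy; apply/val_inj/eqP; rewrite -subr_eq0; apply/eqP.
by apply: (@dist_eq0 _ a b); rewrite -(fineK (distB_fin x y)) [fine _]xy.
Qed.

Let Espace_dist_sym x y : Espace_dist x y = Espace_dist y x.
Proof. by rewrite /Espace_dist -opprB distN. Qed.

Let Espace_dist_triangle y x z :
  Espace_dist x z <= Espace_dist x y + Espace_dist y z.
Proof.
rewrite -lee_fin EFinD !fineK//; apply: le_trans (distD _ _ _ _).
by rewrite addrA subrK.
Qed.

HB.instance Definition _ := isMetric.Build R (Espace a b)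
  Espace_distxx Espace_dist_eq0 Espace_dist_sym Espace_dist_triangle.

End EspaceMetric.

Record Snu (nu : profile R) :=
  MkSnu { Snu_val :> Omega R; Snu_valP : Snu_val \in in_Snu nu }.
HB.instance Definition _ nu := [isSub for @Snu_val nu].
HB.instance Definition _ nu := [Choice of Snu nu by <:].
HB.instance Definition _ nu := [SubChoice_isSubLmodule of Snu nu by <:].

Definition Snu_incl (nu : profile R) (a : R) (e : {posnum R}) (x : Snu nu) :
    Espace a (nu a + e%:num%:E)%E :=
  MkEspace (sub_Snu_E a e (Snu_valP x)).

(* The supremum over (n, m) of the initial topologies of the inclusions, i.e., the
   coarsest topology making all of them continuous. *)
Definition Snu_space (nu : profile R) (alpha : nat -> R) (eps : nat -> {posnum R}) :=
  sup_topology (fun nm : nat * nat => Topological.class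
    (initial_topology (@Snu_incl nu (alpha nm.1) (eps nm.2)))).
HB.instance Definition _ nu alpha eps := Topological.on (Snu_space nu alpha eps).
HB.instance Definition _ nu alpha eps :=
  GRing.Lmodule.copy (Snu_space nu alpha eps) (Snu nu).

End Spaces.

Definition is_pnorm (R : realType) (X : lmodType R[i]) (p : R) (q : X -> R) : Prop :=
  [/\ forall x, 0 <= q x,
      forall (l : R[i]) x, q (l *: x) = normc l * q x,
      forall x y, q (x + y) `^ p <= q x `^ p + q y `^ p &
      forall x, q x = 0 -> x = 0].

(* The balls of the p-norm [q] are those of the metric [q (x - y) `^ p], up to
   a reparametrization of the radii. *)
Definition pnormable (R : realType) (p : R) (X : preTopologicalLmodType R[i]) : Prop :=
  exists2 q : X -> R, is_pnorm p q &
    forall x : X, nbhs x =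
      filter_from [set r : R | 0 < r] (fun r => [set y | q (y - x) < r]).

(* Main.v *)
(* A [p]-norm [q] would have a bounded unit ball containing some basic
   neighbourhood [W] of 0, cut out by finitely many conditions
   [d_{alpha_n, nu(alpha_n) + eps_m} < r].  If [nu >= 0] everywhere, a single
   coefficient, however large, at a fixed large scale belongs to [W]; so [W]
   contains a line, on which [q] must vanish.  Otherwise choose [alpha_n'] with
   [nu(alpha_n') = -oo] above all the [alpha_n] of [W] with
   [nu(alpha_n) = -oo]: a single coefficient of size [c 2^(-alpha_n' j)] at
   scale [j] belongs to [W] for [j] large, whatever [c] is, whereas
   [d_{alpha_n', -oo}] is not small at that sequence, so [W] is unbounded. *)
Require Import Defs.
From HB Require Import structures.
From mathcomp Require Import all_boot all_order all_algebra.
From mathcomp Require Import all_classical all_reals all_analysis.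
From mathcomp Require Import complex lra.

Set Implicit Arguments.
Unset Strict Implicit.
Unset Printing Implicit Defensive.

Import Order.TTheory GRing.Theory Num.Theory.
Import numFieldNormedType.Exports.
Import Normc.

Local Open Scope classical_set_scope.
Local Open Scope ring_scope.

(** * Sequences with at most one nonzero coefficient *)

Section Spike.
Context {R : realType}.
Implicit Types (a c s t C : R) (b : \bar R) (j : nat).

Definition spike j s : Omega R :=
  fun l => (if (tag l == j) && (tagged l == 0%N :> nat) then s else 0)%:C%C.

Lemma spikeZ c j s : c%:C%C *: spike j s = spike j (c * s).
Proof.
apply/funext => l; rewrite /spike.
have -> (f : Omega R) : (c%:C%C *: f) l = c%:C%C * f l by [].
by rewrite -rmorphM; case: ifP => _; rewrite ?mulr0.
Qed.

Lemma normc_coef_spike j s i (k : 'I_(2 ^ i)%N) :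
  normc (coef (spike j s) k) = if (i == j) && (k == 0%N :> nat) then `|s| else 0.
Proof.
rewrite /coef /spike /normc /= expr0n addr0 sqrtr_sqr.
by case: ifP; rewrite ?normr0.
Qed.

Lemma card_ge_spike_neq j s i t : 0 < t -> i != j ->
  card_ge (spike j s) i t = 0%N.
Proof.
by move=> t0 /negbTE ij; apply: card_ge_eq0 => k; rewrite normc_coef_spike ij.
Qed.

Lemma card_ge_spike_le1 j s i t : 0 < t -> (card_ge (spike j s) i t <= 1)%N.
Proof.
move=> t0; apply/card_le1_eqP => k l; rewrite !inE !normc_coef_spike.
case: ifP => [/andP[_ /eqP k0]|_]; last by rewrite leNgt t0.
case: ifP => [/andP[_ /eqP l0] _ _|_ _]; last by rewrite leNgt t0.
by apply: val_inj; rewrite /= k0 l0.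
Qed.

Lemma card_ge_spike_gt0 j s t : t <= `|s| -> (0 < card_ge (spike j s) j t)%N.
Proof.
move=> ts; have j0 : (0 < 2 ^ j)%N by rewrite expn_gt0.
by apply/card_gt0P; exists (Ordinal j0); rewrite !inE normc_coef_spike !eqxx.
Qed.

(** At scale [j], either the coefficient lies below the threshold and nothing is counted, or a count
    of 1 is allowed and the size of [s] is irrelevant. *)
Lemma dist_bound_spike a b j s C : 0 < C ->
  `|s| < C * 2 `^ (- (a * j%:R)) \/ 1 <= C * pow2 b j ->
  dist_bound a b (spike j s) C.
Proof.
move=> C0 sC; split=> [|i]; first exact: ltW.
have t0 : 0 < C * 2 `^ (- (a * i%:R)) by rewrite mulr_gt0// powR_gt0.
have [ij|ij] := eqVneq i j; last first.
  by rewrite card_ge_spike_neq// mulr_ge0 ?pow2_ge0// ltW.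
case: sC => [sC|]; rewrite -ij.
  rewrite card_ge_eq0 ?mulr_ge0 ?pow2_ge0 ?(ltW C0)// => k.
  by rewrite normc_coef_spike; case: ifP => // _; rewrite ij.
by apply: le_trans; rewrite -[leRHS]/(1%:R) ler_nat card_ge_spike_le1.
Qed.

Lemma dist_bound_Ny_spike a j s C :
  dist_bound a -oo%E (spike j s) C -> `|s| < C * 2 `^ (- (a * j%:R)).
Proof.
move=> [_ /(_ j)]; rewrite /= mulr0 lern0; apply: contraTT; rewrite -leNgt -lt0n.
exact: card_ge_spike_gt0.
Qed.

(** Membership only constrains large scales, and beyond [j] every coefficient is zero. *)
Lemma spike_in_Snu (nu : profile R) j s : spike j s \in in_Snu nu.
Proof.
apply/in_SnuP => a h h0; exists 1 => //; near=> i.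
rewrite card_ge_spike_neq ?pow2_ge0 ?powR_gt0// gtn_eqF//.
by near: i; exact: nbhs_infty_gt.
Unshelve. all: by end_near. Qed.

Definition Snu_spike (nu : profile R) j s : Snu nu :=
  MkSnu (spike_in_Snu nu j s).

Lemma Snu_spikeZ (nu : profile R) c j s :
  c%:C%C *: Snu_spike nu j s = Snu_spike nu j (c * s).
Proof. by apply: val_inj; rewrite /= -spikeZ. Qed.

End Spike.

(** * Neighbourhoods of 0 in the topology of [Snu_space] *)

Section Neighborhoods.
Context {R : realType}.
Variables (nu : profile R) (alpha : nat -> R) (eps : nat -> {posnum R}).
Let d (nm : nat * nat) : Omega R -> \bar R :=
  dist (alpha nm.1) (nu (alpha nm.1) + (eps nm.2)%:num%:E)%E.

Lemma Snu_incl_ball nm r (x : Snu nu) : 0 < r ->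
  ball (Snu_incl (alpha nm.1) (eps nm.2) 0) r (Snu_incl (alpha nm.1) (eps nm.2) x)
  <-> (d nm (val x) < r%:E)%E.
Proof.
move=> r0; rewrite ballEmdist /= /mdist /= /Espace_dist /= sub0r distN.
have xfin : d nm (val x) \is a fin_num.
  by rewrite ge0_fin_numE ?dist_ge0//; exact: (sub_Snu_E _ _ (Snu_valP x)).
by rewrite -[X in _ <-> (X < _)%E](fineK xfin) lte_fin.
Qed.

Lemma nbhs_Snu0_dist_lt nm r : 0 < r ->
  nbhs (0 : Snu_space nu alpha eps)
    [set x : Snu_space nu alpha eps | (d nm (Snu_val x) < r%:E)%E].
Proof.
move=> r0.
have F0 : Filter (nbhs (0 : Snu_space nu alpha eps)) by exact: nbhs_filter.
(* The neighbourhood filter of 0 converges to 0 for the supremum topology, hence for the initial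
   topology of each index [nm]. *)
have [+ _] := cvg_sup (fun nm : nat * nat => Topological.class
  (initial_topology (@Snu_incl R nu (alpha nm.1) (eps nm.2)))) (0 : Snu nu) F0.
move=> /(_ (fun _ => id) nm); apply.
have : nbhs (0 : initial_topology (@Snu_incl R nu (alpha nm.1) (eps nm.2)))
    (Snu_incl (alpha nm.1) (eps nm.2) @^-1`
      ball (Snu_incl (alpha nm.1) (eps nm.2) 0) r).
  exact: (@initial_continuous (Snu nu) _
    (@Snu_incl R nu (alpha nm.1) (eps nm.2)) (0 : Snu nu) _ (nbhsx_ballx _ _ r0)).
by apply: filterS => x /(Snu_incl_ball nm x r0).
Qed.

(** One radius serves all conditions, since finitely many radii have a positive minimum. *)
Definition dist_nbhs0 : set_system (Snu_space nu alpha eps) :=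
  [set A | exists s : seq (nat * nat), exists2 r, 0 < r &
    forall x : Snu_space nu alpha eps,
      (forall nm, nm \in s -> (d nm (Snu_val x) < r%:E)%E) -> A x].

Lemma dist_nbhs0_filter : Filter dist_nbhs0.
Proof.
split.
- by exists [::], 1.
- move=> A B [s [r r0 sA]] [t [u u0 tB]].
  exists (s ++ t), (Num.min r u); first by rewrite lt_min r0.
  move=> x stx; split; [apply: sA|apply: tB] => nm nms.
    by rewrite (lt_le_trans (stx _ _)) ?mem_cat ?nms// lee_fin ge_min lexx.
  by rewrite (lt_le_trans (stx _ _)) ?mem_cat ?nms ?orbT// lee_fin ge_min lexx orbT.
- by move=> A B AB [s [r r0 sA]]; exists s, r => // x /sA /AB.
Qed.

(** The filter [dist_nbhs0] converges to 0 in each initial topology, hence in their supremum, so it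
    contains every neighbourhood of 0. *)
Lemma nbhs_Snu0_dist (A : set (Snu_space nu alpha eps)) :
  nbhs (0 : Snu_space nu alpha eps) A -> dist_nbhs0 A.
Proof.
have F0 := dist_nbhs0_filter.
have [_] := cvg_sup (fun nm : nat * nat => Topological.class
  (initial_topology (@Snu_incl R nu (alpha nm.1) (eps nm.2)))) (0 : Snu nu) F0.
apply=> nm B [_ [[V Vo <-] V0 VB]].
have /nbhs_ballP[r /= r0 rV] := open_nbhs_nbhs (conj Vo V0).
exists [:: nm], r => // x xr; apply/VB/rV/Snu_incl_ball => //.
by apply: xr; rewrite mem_head.
Qed.

End Neighborhoods.

(** * The set where the profile is -oo *)

Section ProfileNy.
Context {R : realType}.
Variable nu : profile R.

Lemma profile_ge0 a : nu a <> -oo%E -> (0 <= nu a)%E.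
Proof. by have [/(_ a)[//|/andP[]]] := profileP nu. Qed.

(** The profile takes no finite negative value, so right-continuity keeps it at -oo just to the
    right of [a]. *)
Lemma profile_Ny_open a : nu a = -oo%E -> \forall b \near a^'+, nu b = -oo%E.
Proof.
move=> nua; have [_ _ /(_ a) + _] := profileP nu; rewrite nua.
move=> /(_ [set y | (y < 0)%E]); case; first by exists 0; split.
move=> r /= r0 H; exists r => //= b ab ltab.
by apply: contrapT => /profile_ge0; rewrite leNgt; move/negP; apply; exact: H.
Qed.

(** Strictness matters: the ratio of the thresholds 2^(-a j) and 2^(-alpha_n j) then tends to
    infinity with j. *)
Lemma profile_Ny_dense (alpha : nat -> R) a :
  dense (range alpha) -> nu a = -oo%E ->
  exists2 n, a < alpha n & nu (alpha n) = -oo%E.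
Proof.
move=> dA /profile_Ny_open[r /= r0 nur].
have [|_ [/= /[swap] [[n _ <-]]]] :=
  dA _ _ (@interval_open R (BRight a) (BLeft (a + r)) isT isT).
  exists (a + r / 2); rewrite /= in_itv /= ltrDl ltrD2l divr_gt0//=.
  by rewrite ltr_pdivrMr// ltr_pMr// ltr1n.
rewrite in_itv /= => /andP[an anr]; exists n => //; apply: nur => //=.
by rewrite /ball /= distrC ger0_norm ?subr_ge0 ?ltW// ltrBlDl.
Qed.

Lemma le_pow2_profile a e j : (0 <= nu a)%E ->
  2 `^ (e * j%:R) <= pow2 (nu a + e%:E)%E j.
Proof.
have := profile_neqy nu a; case: (nu a) => [r| |]//= _; rewrite lee_fin => r0.
by rewrite ler_powR ?ler1n// ler_wpM2r// lerDr.
Qed.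

End ProfileNy.

(** * Estimates at large scales and the contradiction *)

Lemma near_lt_powR (R : realType) (M d : R) : 0 < d ->
  \forall j \near \oo, M < 2 `^ (d * j%:R).
Proof.
move=> d0; have ln20 : 0 < ln (2 : R) by rewrite ln_gt0// ltr1n.
(* This uses exp t >= 1 + t with t = d j ln 2. *)
near=> j; apply: (@lt_le_trans _ _ (1 + d * j%:R * ln 2)); last first.
  by rewrite /powR ifF ?expR_ge1Dx ?pnatr_eq0.
rewrite -ltrBlDl mulrAC -ltr_pdivrMl ?mulr_gt0//.
by near: j; exact: nbhs_infty_gtr.
Unshelve. all: by end_near. Qed.

Lemma near_all (I : eqType) (s : seq I) (P : I -> nat -> Prop) :
  (forall i, i \in s -> \forall j \near \oo, P i j) ->
  \forall j \near \oo, forall i, i \in s -> P i j.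
Proof.
elim: s => [|i s IHs] Ps; first by near=> j.
have Pi := Ps i (mem_head _ _).
have {}IHs := IHs (fun k ks => Ps k (mem_behead (s := i :: s) ks)).
near=> j => k; rewrite inE => /orP[/eqP->|]; first by near: j.
by move: k; near: j.
Unshelve. all: by end_near. Qed.

Theorem proposition3p1 (R : realType) (nu : profile R)
    (alpha : nat -> R) (alpha_dense : dense (range alpha))
    (eps : nat -> {posnum R})
    (eps_nonincreasing : nonincreasing_seq (fun m => (eps m)%:num))
    (eps_cvg0 : (eps m)%:num @[m --> \oo] --> (0 : R))
    (p : R) (p_gt0 : 0 < p) (p_le1 : p <= 1) :
  ~ pnormable p (Snu_space nu alpha eps).
Proof.
move=> [q [q0 qZ _ q_eq0] nbhsq].
pose sp j c : Snu_space nu alpha eps := Snu_spike nu j c.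
have [|s [r r0 sq]] := @nbhs_Snu0_dist R nu alpha eps [set y | q y < 1].
  by rewrite nbhsq; exists 1 => [//=|y]; rewrite /= ?subr0.
(* Halving [r] turns the non-strict bound of [dist_le] into the strict inequality required by
   [sq]. *)
have r20 : 0 < r / 2 by rewrite divr_gt0.
have sp_lt1 j c : (forall nm, nm \in s ->
    `|c| < r / 2 * 2 `^ (- (alpha nm.1 * j%:R)) \/
    1 <= r / 2 * pow2 (nu (alpha nm.1) + (eps nm.2)%:num%:E) j) -> q (sp j c) < 1.
  move=> H; apply: sq => nm /H /(dist_bound_spike r20)/dist_le.
  by move=> /le_lt_trans; apply; rewrite lte_fin ltr_pdivrMr// ltr_pMr// ltr1n.
have spZ j c d : q (sp j (c * d)) = `|c| * q (sp j d).
  by rewrite /sp -Snu_spikeZ qZ /normc /= expr0n addr0 sqrtr_sqr.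
(* The positive [eps] makes the allowed count grow even where the profile is 0. *)
have ge0P nm : (0 <= nu (alpha nm.1))%E -> \forall j \near \oo,
    1 <= r / 2 * pow2 (nu (alpha nm.1) + (eps nm.2)%:num%:E) j.
  move=> nu0; near=> j; rewrite mulrC -ler_pdivrMr//.
  rewrite (le_trans _ (le_pow2_profile _ _ nu0))//.
  by apply/ltW; near: j; exact: near_lt_powR.
have [[a nua]|nuN] := pselect (exists a, nu a = -oo%E); last first.
  have nu0 a : (0 <= nu a)%E by apply: profile_ge0 => nua; apply: nuN; exists a.
  have [j _ /(_ j (leqnn _)) js] := near_all (fun nm (_ : nm \in s) => ge0P nm (nu0 _)).
  have q1 c : q (sp j c) < 1 by apply: sp_lt1 => nm /js; right.
  have /q_eq0 sp0 : q (sp j 1) = 0.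
    apply/eqP; rewrite eq_le q0 andbT leNgt; apply/negP => qj.
    (* The spike rescaled to [q]-value 1 contradicts [q1]. *)
    have := q1 ((q (sp j 1))^-1 * 1).
    by rewrite spZ ger0_norm ?invr_ge0// mulVf ?gt_eqF// ltxx.
  have := card_ge_spike_gt0 j (lexx `|1 : R|).
  have -> : spike j 1 = 0 :> Omega R by exact: (congr1 (@Snu_val R nu) sp0).
  rewrite card_ge_eq0// => k.
  by rewrite normr1 /coef [X in normc X]/= [normc _]normc0.
(* [b] is the maximum of [a] and the finitely many [alpha nm.1] concerned; starting from [a] covers
   the case where there are none. *)
have [b nub sb] : exists2 b, nu b = -oo%E &
    forall nm, nm \in s -> nu (alpha nm.1) = -oo%E -> alpha nm.1 <= b.
  elim: (s) => [|nm t [b nub tb]]; first by exists a.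
  have [nuN|nuN] := pselect (nu (alpha nm.1) = -oo%E); last first.
    by exists b => // nm'; rewrite inE => /orP[/eqP->|/tb].
  exists (Num.max b (alpha nm.1)); first by case: leP.
  move=> nm'; rewrite inE le_max => /orP[/eqP->|/tb H /H ->//].
  by rewrite lexx orbT.
have [n bn nun] := profile_Ny_dense alpha_dense nub.
(* Any second index would do, since adding [eps] to -oo gives -oo. *)
have := @nbhs_Snu0_dist_lt R nu alpha eps (n, 0%N) 1 ltr01.
rewrite nbhsq => -[rho /= rho0 qrho].
(* The spike put in the unit ball is [rho^-1] times the one of size 2^(-alpha_n j); homogeneity then
   puts the latter in the [q]-ball of radius [rho]. *)
have [j _ /(_ j (leqnn _)) js] : \forall j \near \oo, forall nm, nm \in s ->
    rho^-1 * 2 `^ (- (alpha n * j%:R)) < r / 2 * 2 `^ (- (alpha nm.1 * j%:R)) \/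
    1 <= r / 2 * pow2 (nu (alpha nm.1) + (eps nm.2)%:num%:E) j.
  apply: near_all => nm nms.
  have [nuN|/profile_ge0/ge0P] := pselect (nu (alpha nm.1) = -oo%E); last first.
    by apply: filterS => j; right.
  have nmn := le_lt_trans (sb _ nms nuN) bn.
  near=> j; left.
  have -> : - (alpha nm.1 * j%:R) =
    - (alpha n * j%:R) + (alpha n - alpha nm.1) * j%:R by lra.
  rewrite powRD; last by rewrite pnatr_eq0 implybT.
  rewrite mulrCA mulrC ltr_pM2l ?powR_gt0// -ltr_pdivrMl//.
  by near: j; apply: near_lt_powR; rewrite subr_gt0.
have w0 : 0 < 2 `^ (- (alpha n * j%:R)) :> R by exact: powR_gt0.
have : q (sp j (2 `^ (- (alpha n * j%:R)))) < rho.
  rewrite -[X in sp j X](mulVKf (lt0r_neq0 rho0)) spZ ger0_norm ?ltW//.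
  rewrite -[ltRHS]mulr1 ltr_pM2l//; apply: sp_lt1 => nm /js.
  by rewrite ger0_norm// mulr_ge0 ?invr_ge0 ?ltW.
(* With exponent -oo, distance below 1 forces the coefficient strictly below 2^(-alpha_n j), which
   is its own size. *)
rewrite -[X in q X]subr0 => /qrho /= /dist_lt; rewrite nun.
by move=> /dist_bound_Ny_spike; rewrite mul1r ger0_norm ?ltxx// ltW.
Unshelve. all: by end_near. Qed.
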